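(* Let $E$ be an $n$-dimensional vector space over a field $\mathbb{F}$, and let $(E,\mathcal{C})$ be a $q$-matroid given by its collection of circuits, i.e. $\mathcal{C}\subseteq\mathcal{L}(E)$ satisfies (C1), (C2) and (C3). Define \[ \mathcal{I}_{\mathcal{C}}=\{I\subseteq E \text{ a subspace}: C\not\subseteq I\text{ for all }C\in\mathcal{C}\}. \] Then $\mathcal{I}_{\mathcal{C}}$ is a family of independent spaces, that is, it satisfies the axioms (I1), (I2) and (I4'').
   Context: $n$ is a positive integer, $\mathbb{F}$ is an arbitrary field, and $\mathcal{L}(E)$ denotes the lattice of all subspaces of $E$. For a family $\mathcal{A}\subseteq\mathcal{L}(E)$ and $X\in\mathcal{L}(E)$, $\max(X,\mathcal{A})$ is the set of members of $\mathcal{A}$ contained in $X$ that have the largest dimension among all members of $\mathcal{A}$ contained in $X$. Circuit axioms for $\mathcal{C}\subseteq\mathcal{L}(E)$: (C1) $\{0\}\notin\mathcal{C}$. (C2) For all $C_1,C_2\in\mathcal{C}$, if $C_1\subseteq C_2$, then $C_1=C_2$. (C3) For distinct $C_1,C_2\in\mathcal{C}$ and any $X\in\mathcal{L}(E)$ of codimension $1$ in $E$, there is $C_3\in\mathcal{C}$ such that $C_3\subseteq(C_1+C_2)\cap X$. Axioms for $\mathcal{I}\subseteq\mathcal{L}(E)$: (I1) $\mathcal{I}\neq\emptyset$. (I2) For all $I,J\in\mathcal{L}(E)$, if $J\in\mathcal{I}$ and $I\subseteq J$, then $I\in\mathcal{I}$. (I4'') Let $A\in\mathcal{L}(E)$ and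 let $I\in\max(A,\mathcal{I})$. Let $x\in\mathcal{L}(E)$ be a $1$-dimensional space. Then there exists $J\in\max(x+A,\mathcal{I})$ such that $J\subseteq x+I$. *)

(* Defs.v *)
From HB Require Import structures.
From mathcomp Require Import all_boot all_order all_algebra.
From mathcomp Require Import boolp classical_sets.

Set Implicit Arguments.
Unset Strict Implicit.
Unset Printing Implicit Defensive.

Import GRing.Theory.
Local Open Scope classical_set_scope.

Section QMatroid.
Variables (F : fieldType) (E : vectType F).
Implicit Types (A X x C I J : {vspace E}) (S CC II : set {vspace E}).

Definition max_in X S : set {vspace E} :=
  [set I | [/\ S I, (I <= X)%VS &
    forall J, S J -> (J <= X)%VS -> (\dim J <= \dim I)%N]].

Definition axiomC1 CC : Prop := ~ CC 0%VS.

Definition axiomC2 CC : Prop :=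
  forall C1 C2, CC C1 -> CC C2 -> (C1 <= C2)%VS -> C1 = C2.

Definition axiomC3 CC : Prop :=
  forall C1 C2, CC C1 -> CC C2 -> C1 <> C2 ->
  forall X, (\dim X).+1 = \dim {:E} ->
  exists2 C3, CC C3 & (C3 <= (C1 + C2) :&: X)%VS.

Definition is_circuit_family CC : Prop :=
  [/\ axiomC1 CC, axiomC2 CC & axiomC3 CC].

Definition axiomI1 II : Prop := II !=set0.

Definition axiomI2 II : Prop :=
  forall I J, II J -> (I <= J)%VS -> II I.

Definition axiomI4'' II : Prop :=
  forall A I, max_in A II I ->
  forall x, \dim x = 1%N ->
  exists2 J, max_in (x + A)%VS II J & (J <= x + I)%VS.

Definition is_independent_family II : Prop :=
  [/\ axiomI1 II, axiomI2 II & axiomI4'' II].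

Definition indep_of_circuits CC : set {vspace E} :=
  [set I | forall C, CC C -> ~~ (C <= I)%VS].

End QMatroid.

(* Main.v *)
Require Import Defs.
From mathcomp Require Import all_boot all_order all_algebra.
From mathcomp Require Import boolp classical_sets.

(** The engine is the following form of circuit elimination: two distinct
    circuits inside [W] force a circuit inside every hyperplane [H] of [W]
    ([circuit_in_hyperplane]).  Indeed [H] is the trace on [W] of a hyperplane
    of [E], to which (C3) applies.  Hence a space with an independent
    hyperplane contains at most one circuit ([circuit_unique]).

    Two consequences give (I4'').

    - Extension ([indep_extend]): if [I] and [J] are independent subspaces of
      [A] and [\dim I < \dim J], then some independent space strictly larger
      than [I] lies between [I] and [A].  As for ordinary matroids, one rotates
      [J] towards [I]: choose [e] in [I] outside [J], and trade a hyperplane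
      [H] of [J] containing [I :&: J] for [H + <[e]>].  If every such trade
      produced a dependent space, the unique circuit of [J + <[e]>] would lie
      in all the spaces [H + <[e]>], whose intersection [(I :&: J) + <[e]>] is
      contained in the independent space [I].

    - Let [I] be maximal in [A], let [v] be a vector outside [A], and suppose
      that [<[v]> + I] is dependent.  If [<[v]> + A] contained an independent
      space of dimension larger than [\dim I], extension would give [y]
      outside [A] with [I + <[y]>] independent, where [y = a + k *: v] for
      some [a] in [A] and some nonzero [k].  If [a] is in [I], then
      [I + <[y]> = I + <[v]>] is dependent: a contradiction.  Otherwise
      [I + <[a]>] contains a circuit by maximality of [I], [I + <[v]>] contains
      another one, and eliminating in [I + <[a]> + <[v]>] puts a circuit inside
      its hyperplane [I + <[y]>]: a contradiction.  So [I] itself is maximal in [<[v]> + A].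

    When [<[v]> + I] is independent it is maximal in [<[v]> + A], because an
    independent [J] in [<[v]> + A] loses at most one dimension when
    intersected with [A]. *)

Set Implicit Arguments.
Unset Strict Implicit.
Unset Printing Implicit Defensive.

Import GRing.Theory.
Local Open Scope ring_scope.

(** * Hyperplanes of a subspace *)

Section Subspaces.
Variables (F : fieldType) (E : vectType F).
Implicit Types (U V W H J X : {vspace E}) (u v h : E).

Lemma capv_vline_eq0 U v : v \notin U -> (U :&: <[v]> = 0)%VS.
Proof.
move=> vU; apply/eqP; rewrite -subv0; apply/subvP => w /memv_capP [wU].
case/vlineP => k kE; rewrite kE in wU *.
have [->|k0] := eqVneq k 0; first by rewrite scale0r mem0v.
by move: vU; rewrite -(scale1r v) -(mulVf k0) -scalerA memvZ.
Qed.

Lemma dim_addv_vline U v : v \notin U -> \dim (U + <[v]>) = (\dim U).+1.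
Proof.
move=> vU; rewrite dimv_disjoint_sum ?capv_vline_eq0 // dim_vline.
have -> : v != 0 by apply: contraNneq vU => ->; rewrite mem0v.
by rewrite addn1.
Qed.

Lemma mem_vline_addP U v w :
  reflect (exists2 u, u \in U & exists k, w = u + k *: v) (w \in U + <[v]>)%VS.
Proof.
apply: (iffP memv_addP) => [[u uU [_ /vlineP [k ->] ->]] | [u uU [k ->]]].
  by exists u => //; exists k.
by exists u => //; exists (k *: v); rewrite ?memvZ ?memv_line.
Qed.

(** The witness is [H + W^C]: by the modular law, it meets [W] in
    [H + (W^C :&: W) = H]. *)
Lemma hyperplane_trace H W : (H <= W)%VS -> (\dim H).+1 = \dim W ->
  exists2 X, (\dim X).+1 = \dim {:E} & (W :&: X = H)%VS.
Proof.
move=> HW dH; exists (H + W^C)%VS.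
  rewrite dimv_disjoint_sum; last first.
    by apply/eqP; rewrite -subv0 -(capv_compl W) capvS.
  by rewrite dimv_compl -addSn dH subnKC // dimvS // subvf.
by rewrite capvC -vspace_modl // [(W^C :&: W)%VS]capvC capv_compl addv0.
Qed.

Lemma hyperplane_avoiding U J h : (U <= J)%VS -> h \in J -> h \notin U ->
  exists2 H, [/\ (U <= H)%VS, (H <= J)%VS & (\dim H).+1 = \dim J] & h \notin H.
Proof.
move=> UJ hJ hU; pose V := (U + <[h]>)%VS; pose D := (J :\: V)%VS.
have VJ : (V <= J)%VS by rewrite subv_add UJ -memvE.
have DV : (D + V = J)%VS.
  by rewrite addv_diff; apply/addv_idPl.
have dJ : (\dim D + \dim V)%N = \dim J.
  by rewrite -DV dimv_disjoint_sum // capv_diff.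
have dUD : (\dim (U + D)).+1 = \dim J.
  rewrite dimv_disjoint_sum; last first.
    apply/eqP; rewrite -subv0 -(capv_diff J V) capvC capvS //.
    exact: addvSl.
  by rewrite -dJ dim_addv_vline // addnS addnC.
exists (U + D)%VS; first by split; rewrite ?addvSl // subv_add UJ diffvSl.
apply/negP => hUD; suff : (J <= U + D)%VS by move/dimvS; rewrite -dUD ltnn.
by rewrite -DV !subv_add addvSr addvSl -memvE hUD.
Qed.

End Subspaces.

(** * Circuits and independent spaces *)

Section Circuits.
Variables (F : fieldType) (E : vectType F) (CC : set {vspace E}).
Hypothesis circuitsCC : is_circuit_family CC.
Implicit Types (A C H I J W x : {vspace E}).

Local Notation indep := (indep_of_circuits CC).

Lemma indepS I J : indep J -> (I <= J)%VS -> indep I.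
Proof.
by move=> iJ IJ C CCC; apply: contra (iJ C CCC) => /subv_trans; apply.
Qed.

Lemma dependentP I : ~ indep I -> exists2 C, CC C & (C <= I)%VS.
Proof.
move=> nI; apply: contrapT => nC; apply: nI => C CCC.
by apply/negP => CI; apply: nC; exists C.
Qed.

Lemma indep0 : indep 0%VS.
Proof.
case: circuitsCC => C1 _ _ C CCC; apply/negP; rewrite subv0 => /eqP C0.
by apply: C1; rewrite -C0.
Qed.

(** The hyperplane in (C3) lives in [E]; passing to traces gives elimination
    relative to any space that contains both circuits. *)
Lemma circuit_in_hyperplane H W C1 C2 :
    CC C1 -> CC C2 -> C1 <> C2 -> (C1 <= W)%VS -> (C2 <= W)%VS ->
  (H <= W)%VS -> (\dim H).+1 = \dim W -> ~ indep H.
Proof.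
move=> c1 c2 c12 C1W C2W HW dH iH; have [X dX WX] := hyperplane_trace HW dH.
case: circuitsCC => _ _ /(_ _ _ c1 c2 c12 _ dX) [C3 c3 C3X].
apply/negP: (iH _ c3); rewrite negbK -WX (subv_trans C3X) // capvS //.
by rewrite subv_add C1W.
Qed.

(** The counterpart of the fundamental circuit of a basis. *)
Lemma circuit_unique J e C1 C2 : indep J -> e \notin J ->
  CC C1 -> CC C2 -> (C1 <= J + <[e]>)%VS -> (C2 <= J + <[e]>)%VS -> C1 = C2.
Proof.
move=> iJ eJ c1 c2 C1J C2J; apply: contrapT => c12.
apply: (circuit_in_hyperplane c1 c2 c12 C1J C2J (addvSl _ _)) iJ.
by rewrite dim_addv_vline.
Qed.

(** The rotation step of [indep_extend]: [H + <[e]>] has the dimension of [J],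
    and it meets [I] in a larger space because it gains [e] and loses nothing
    of [I :&: J].  It fails only if one circuit lies in every [H + <[e]>]; a
    vector [h + k *: e] of that circuit with [h] outside [I] is then ruled out
    by choosing [H] to avoid [h]. *)
Lemma indep_exchange I J e :
    indep I -> indep J -> (\dim I < \dim J)%N -> e \in I -> e \notin J ->
  exists2 H, [/\ (I :&: J <= H)%VS, (H <= J)%VS & (\dim H).+1 = \dim J] &
             indep (H + <[e]>)%VS.
Proof.
move=> iI iJ dIJ eI eJ; apply: contrapT => noH.
have dep H : (I :&: J <= H)%VS -> (H <= J)%VS -> (\dim H).+1 = \dim J ->
    exists2 C, CC C & (C <= H + <[e]>)%VS.
  by move=> IJH HJ dH; apply: dependentP => iH; apply: noH; exists H.
have /subvPn [h0 h0J h0I] : ~~ (J <= I :&: J)%VS.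
  apply: contraL dIJ => /dimvS dJ.
  by rewrite -leqNgt (leq_trans dJ) // dimvS // capvSl.
have [H0 [IH0 H0J dH0] _] := hyperplane_avoiding (capvSr I J) h0J h0I.
have [C cC CH0] := dep _ IH0 H0J dH0.
have CJ : (C <= J + <[e]>)%VS by rewrite (subv_trans CH0) // addvS.
apply/negP: (iI _ cC); rewrite negbK.
suff CIJ : (C <= (I :&: J) + <[e]>)%VS.
  by rewrite (subv_trans CIJ) // subv_add capvSl -memvE.
apply/subvP => c cinC.
have /mem_vline_addP [h hJ [k cE]] := subvP CJ _ cinC.
apply/mem_vline_addP; exists h; last by exists k.
apply: contrapT => /negP hI.
have [H [IH HJ dH] hH] := hyperplane_avoiding (capvSr I J) hJ hI.
have [C' cC' C'H] := dep _ IH HJ dH.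
have CC' : C = C'.
  by apply: (circuit_unique iJ eJ) => //; rewrite (subv_trans C'H) // addvS.
have /mem_vline_addP [h' h'H [k' cE']] : c \in (H + <[e]>)%VS.
  by apply: (subvP C'H); rewrite -CC'.
(* Both decompositions of c along J + <[e]> agree, since e is outside J. *)
have hh' : h - h' = (k' - k) *: e.
  by rewrite scalerBl; apply/eqP; rewrite subr_eq addrAC eq_sym subr_eq
    addrC -cE' cE.
have : h - h' \in (J :&: <[e]>)%VS.
  apply/memv_capP; split; first by rewrite memvB // (subvP HJ).
  by rewrite hh' memvZ ?memv_line.
rewrite capv_vline_eq0 // memv0 subr_eq0 => /eqP hE.
by rewrite hE h'H in hH.
Qed.

(** The induction is on the codimension of [I :&: J] in [I], which each
    exchange decreases; it ends when [J] itself contains [I]. *)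
Lemma indep_extend A I J : indep I -> indep J -> (I <= A)%VS -> (J <= A)%VS ->
    (\dim I < \dim J)%N ->
  exists2 K, indep K & [/\ (I <= K)%VS, (K <= A)%VS & (\dim I < \dim K)%N].
Proof.
move=> iI iJ IA; have [m] := ubnP (\dim I - \dim (I :&: J)).
elim: m J iJ => // m IHm J iJ lem JA dIJ.
have [IJ | /subvPn [e eI eJ]] := boolP (I <= J)%VS; first by exists J.
have [H [IJH HJ dH] iHe] := indep_exchange iI iJ dIJ eI eJ.
have eH : e \notin H by apply: contra eJ => /(subvP HJ).
apply: (IHm _ iHe); last 2 first.
- by rewrite subv_add (subv_trans HJ) // -memvE (subvP IA).
- by rewrite dim_addv_vline // dH.
have eIJ : e \notin (I :&: J)%VS by rewrite memv_cap (negPf eJ) andbF.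
have ltIJ : (\dim (I :&: J) < \dim (I :&: (H + <[e]>)))%N.
  rewrite -(dim_addv_vline eIJ) dimvS // subv_cap !subv_add capvSl -!memvE eI.
  by rewrite (subv_trans IJH) ?addvSl // memvE addvSr.
have leI : (\dim (I :&: (H + <[e]>)) <= \dim I)%N by rewrite dimvS // capvSl.
by rewrite -ltnS (leq_trans _ lem) // ltnS ltn_sub2l // (leq_trans ltIJ).
Qed.

(** The bound follows from the dimension formula for [J] and [A], as
    [J :&: A] is an independent subspace of [A]. *)
Lemma max_in_add_indep A I v : max_in A indep I -> v \notin A ->
  indep (I + <[v]>)%VS -> max_in (A + <[v]>)%VS indep (I + <[v]>)%VS.
Proof.
case=> iI IA maxI vA iIv; split => // [|J iJ JA]; first exact: addvS.
rewrite dim_addv_vline; last by apply: contra vA => /(subvP IA).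
have leJA : (\dim (J :&: A) <= \dim I)%N.
  by apply: maxI; [exact: indepS (capvSl _ _) | exact: capvSr].
have leS : (\dim (J + A) <= (\dim A).+1)%N.
  by rewrite -(dim_addv_vline vA) dimvS // subv_add JA addvSl.
rewrite -(leq_add2r (\dim A)) -dimv_sum_cap addSnnS addnC.
by rewrite leq_add.
Qed.

(** A larger independent space in [A + <[v]>] yields [y = a + k *: v] with
    [I + <[y]>] independent.  This is a hyperplane of [I + <[a]> + <[v]>], where
    the circuits through [a] and through [v] can be eliminated. *)
Lemma max_in_add_dep A I v : max_in A indep I -> v \notin A ->
  ~ indep (I + <[v]>)%VS -> max_in (A + <[v]>)%VS indep I.
Proof.
case=> iI IA maxI vA dIv; have IAv := subv_trans IA (addvSl A <[v]>).
split=> // J' iJ' J'A; rewrite leqNgt; apply/negP => ltJ'.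
have [J iJ [IJ JA ltJ]] := indep_extend iI iJ' IAv J'A ltJ'.
have /subvPn [y yJ yA] : ~~ (J <= A)%VS.
  by apply: contraL ltJ => JA'; rewrite -leqNgt maxI.
have vI : v \notin I by apply: contra vA => /(subvP IA).
have yI : y \notin I by apply: contra yA => /(subvP IA).
have /mem_vline_addP [a aA [k yE]] := subvP JA _ yJ.
have k0 : k != 0.
  by apply: contraNneq yA => k0; rewrite yE k0 scale0r addr0.
have [aI | aI] := boolP (a \in I).
  apply: dIv; apply: (indepS iJ); rewrite subv_add IJ -memvE.
  rewrite -(scale1r v) -(mulVf k0) -scalerA memvZ //.
  have -> : k *: v = y - a by rewrite yE addrAC subrr add0r.
  by rewrite memvB // (subvP IJ).
have [C1 c1 C1I] := dependentP dIv.
have IaA : (I + <[a]> <= A)%VS by rewrite subv_add IA -memvE.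
have [C2 c2 C2I] : exists2 C, CC C & (C <= I + <[a]>)%VS.
  apply: dependentP => iIa; have := maxI _ iIa IaA.
  by rewrite dim_addv_vline // ltnn.
have c12 : C1 <> C2.
  move=> C12; apply/negP: (iI _ c1); rewrite negbK.
  have <- : ((I + <[v]>) :&: A = I)%VS.
    by rewrite -vspace_modl // capvC capv_vline_eq0 // addv0.
  by rewrite subv_cap C1I C12 (subv_trans C2I).
have vIa : v \notin (I + <[a]>)%VS by apply: contra vA => /(subvP IaA).
pose W := (I + <[a]> + <[v]>)%VS.
have IyW : (I + <[y]> <= W)%VS.
  rewrite subv_add {1}/W -addvA addvSl -memvE yE.
  apply/mem_vline_addP; exists a; last by exists k.
  by rewrite memvE addvSr.
apply: (circuit_in_hyperplane c1 c2 c12 (W := W) _ _ IyW).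
- by rewrite (subv_trans C1I) // addvS // addvSl.
- by rewrite (subv_trans C2I) // addvSl.
- by rewrite !dim_addv_vline.
- by apply: (indepS iJ); rewrite subv_add IJ -memvE.
Qed.

Lemma indep_axiomI4 : axiomI4'' indep.
Proof.
move=> A I maxI x dx; have [v vx] : exists v, x = <[v]>%VS.
  have x0 : x != 0%VS by rewrite -dimv_eq0 dx.
  exists (vpick x); apply/eqP; rewrite eq_sym eqEdim -memvE memv_pick dx.
  by rewrite dim_vline vpick0 x0.
rewrite {x dx}vx addvC [(_ + I)%VS]addvC.
have [vA | vA] := boolP (v \in A).
  have -> : (A + <[v]> = A)%VS by apply/addv_idPl; rewrite -memvE.
  by exists I; rewrite ?addvSl.
have [iIv | dIv] := pselect (indep (I + <[v]>)%VS).
  by exists (I + <[v]>)%VS; rewrite ?subvv //; apply: max_in_add_indep.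
by exists I; rewrite ?addvSl //; apply: max_in_add_dep.
Qed.

End Circuits.

Theorem theorem34 (n : nat) (hn : (0 < n)%N) (F : fieldType) (E : vectType F)
  (hE : \dim {:E} = n) (CC : set {vspace E}) (hCC : is_circuit_family CC) :
  is_independent_family (indep_of_circuits CC).
Proof.
split; first by exists 0%VS; apply: indep0.
- by move=> I J; apply: indepS.
- exact: indep_axiomI4.
Qed.
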